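(* Let $q\in(0,1)$ and let $\mu$ be a stationary probability measure for the one-dimensional FA-1f process on $\{0,1\}^{\mathbb Z}$. Then there is $\lambda\in[0,1]$ such that $\mu=\lambda\pi+(1-\lambda)\delta_{\mathbf 1}$. The same holds for stationary probability measures of the biased annihilating branching process (BABP) on $\mathbb Z$, and of the $\delta$-West process on $\mathbb Z$ for any $\delta\in(0,1]$.
   Context: Let $p=1-q$. $\pi$ is the product measure on $\Omega=\{0,1\}^{\mathbb Z}$ with $\pi(\eta_x=1)=p$, $\pi(\eta_x=0)=q$, and $\delta_{\mathbf 1}$ is the Dirac mass on the configuration identically equal to $1$. All processes are the Feller processes on $\Omega$ with generator acting on local functions as $$\mathcal Lf(\eta)=\sum_{x\in\mathbb Z}c_x(\eta)\big((1-\eta_x)(1-q)+\eta_xq\big)\big(f(\eta^x)-f(\eta)\big),$$ where $\eta^x$ is $\eta$ flipped at $x$, with: FA-1f: $c_x(\eta)=\mathbf 1_{\{\eta_{x-1}+\eta_{x+1}\ne2\}}$; BABP: $c_x(\eta)=2-\eta_{x-1}-\eta_{x+1}$; $\delta$-West: $c_x(\eta)=(1-\eta_{x-1})+\delta(1-\eta_{x+1})$. *)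

(* Defs.v *)
From HB Require Import structures.
From mathcomp Require Import all_boot all_order all_algebra.
From mathcomp Require Import all_classical all_reals all_analysis.

Set Implicit Arguments.
Unset Strict Implicit.
Unset Printing Implicit Defensive.

Import Order.TTheory GRing.Theory Num.Theory.
Import numFieldNormedType.Exports.

Local Open Scope classical_set_scope.
Local Open Scope ring_scope.

(* Omega = {0,1}^Z, with [true] for 1 and [false] for 0. *)
Definition config : Type := {ptws int -> bool}.
HB.instance Definition _ := Uniform.copy config {ptws int -> bool}.
HB.instance Definition _ := isPointed.Build config (fun=> true).

Definition coordinate_events : set (set config) :=
  [set A | exists x : int, exists b : bool, A = [set eta | eta x = b]].

(* The product sigma-algebra; it is also the Borel sigma-algebra, since the
   index set is countable and bool is discrete and finite. *)
HB.instance Definition _ :=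
  @isMeasurable.Build (sigma_display coordinate_events) config
    <<s coordinate_events>>
    (@sigma_algebra0 _ setT coordinate_events)
    (@sigma_algebraC _ coordinate_events)
    (@sigma_algebra_bigcup _ setT coordinate_events).

Definition ones : config := fun _ => true.

Definition flip (x : int) (eta : config) : config :=
  fun y => if y == x then ~~ eta y else eta y.

Definition local_function (R : realType) (f : config -> R) : Prop :=
  exists s : seq int, forall eta xi : config,
    (forall x, x \in s -> eta x = xi x) -> f eta = f xi.

Definition occ (R : realType) (eta : config) (x : int) : R := (eta x)%:R.
Arguments occ {R}.

Definition rates (R : realType) : Type := int -> config -> R.

Definition fa1f_rate (R : realType) : rates R :=
  fun x eta => (occ eta (x - 1) + occ eta (x + 1) != 2 :> R)%:R.

Definition babp_rate (R : realType) : rates R :=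
  fun x eta => 2 - occ eta (x - 1) - occ eta (x + 1).

Definition west_rate (R : realType) (delta : R) : rates R :=
  fun x eta => (1 - occ eta (x - 1)) + delta * (1 - occ eta (x + 1)).

(* The sum over Z is the finitely supported one: when f is local, all but
   finitely many terms vanish. *)
Definition generator (R : realType) (q : R) (c : rates R) (f : config -> R) :
    config -> R :=
  fun eta => \sum_(x \in [set: int])
    (c x eta * ((1 - occ eta x) * (1 - q) + occ eta x * q)
       * (f (flip x eta) - f eta)).

(* Feller (Markov) semigroups on C(Omega). An operator on C(Omega) is encoded
   as a map on all functions, constrained only on continuous ones; likewise
   S t is constrained only for t >= 0. *)
Record feller_semigroup (R : realType)
    (S : R -> (config -> R) -> (config -> R)) : Prop := FellerSemigroup {
  feller_continuous : forall (t : R) (f : config -> R),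
    0 <= t -> continuous f -> continuous (S t f);
  feller_linear : forall (t a : R) (f g : config -> R),
    0 <= t -> continuous f -> continuous g ->
    S t (fun eta => a * f eta + g eta) =
      (fun eta => a * S t f eta + S t g eta);
  feller_one : forall t : R, 0 <= t -> S t (fun=> 1) = (fun=> 1);
  feller_ge0 : forall (t : R) (f : config -> R),
    0 <= t -> continuous f ->
    (forall eta, 0 <= f eta) -> forall eta, 0 <= S t f eta;
  feller_id : forall f : config -> R, continuous f -> S 0 f = f;
  feller_comp : forall (s t : R) (f : config -> R),
    0 <= s -> 0 <= t -> continuous f ->
    S (s + t) f = S s (S t f);
  feller_cvg : forall f : config -> R, continuous f ->
    {uniform, (fun t : R => S t f) @ 0^'+ --> f}
}.

(* S is the semigroup of the Feller process with rates c: every local function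
   is in the domain of its infinitesimal generator, which acts there as
   [generator q c] (the convergence is in the supremum norm). Local functions
   form a core, so this determines S on C(Omega). *)
Definition feller_process (R : realType) (q : R) (c : rates R)
    (S : R -> (config -> R) -> (config -> R)) : Prop :=
  feller_semigroup S /\
  forall f : config -> R, local_function f ->
    {uniform, (fun (t : R) (eta : config) => t^-1 * (S t f eta - f eta))
                @ 0^'+ --> generator q c f}.

Definition stationary (R : realType)
    (S : R -> (config -> R) -> (config -> R)) (mu : probability config R) :
    Prop :=
  forall (t : R) (f : config -> R), 0 <= t -> continuous f ->
    (\int[mu]_eta (S t f eta)%:E = \int[mu]_eta (f eta)%:E)%E.

(* Prescribing the finite-dimensional marginals determines the measure. *)
Definition bernoulli_product (R : realType) (q : R)
    (P : probability config R) : Prop :=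
  forall (s : seq int) (sigma : config), uniq s ->
    P [set eta : config | forall x, x \in s -> eta x = sigma x] =
      (\prod_(x <- s) (if sigma x then 1 - q else q))%:E.

(* Main.v *)
(* Holley and Stroock's free energy argument.  Let w_n be the density of the
   restriction of mu to [-n, n] with respect to pi, plus 1.  Testing
   stationarity against ln w_n shows that the dissipation of the sites of
   ]-n, n[, which is at least the sum E of the mean values of
   c_x (w_n^{x1} - w_n^{x0})^2 / (w_n^{x1} + w_n^{x0}), is balanced by the
   fluxes at the two sites -n and n.  For every K these fluxes are at most
   O(K^3) F + O(1 / K), where F is the part of the dissipation in [-n-1, n+1]
   that comes from -n and n.  By convexity E grows with n by at least F, and F
   is bounded, so E = 0.  Hence w_n is invariant under all legal flips inside
   the box.  All configurations with a zero in [-n, n] communicate through such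
   flips in a larger box, so mu is a multiple of pi away from the
   configuration 1.

   No lower bound on the rates at the boundary is needed for the estimate of the
   fluxes: where the logarithmic gradient exceeds K, the smaller of the two
   values of w_n is negligible compared to the larger one. *)

Require Import Defs.
From HB Require Import structures.
From mathcomp Require Import all_boot all_order all_algebra.
From mathcomp Require Import all_classical all_reals all_analysis.
From mathcomp Require Import ring lra zify.

Set Implicit Arguments.
Unset Strict Implicit.
Unset Printing Implicit Defensive.

Import Order.TTheory GRing.Theory Num.Theory.
Import numFieldNormedType.Exports.

Local Open Scope classical_set_scope.
Local Open Scope ring_scope.

(** * Real inequalities *)

Section real_inequalities.
Context {R : realType}.
Implicit Types u v U V K : R.

(** The triangular discrimination. It stands in for the entropy dissipation
    [(ln u - ln v) * (u - v)], which it bounds from below, and it is both jointly convex and at most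
    [u + v]. *)
Definition fisher u v := (u - v) ^+ 2 / (u + v).

Lemma fisher_ge0 u v : 0 < u -> 0 < v -> 0 <= fisher u v.
Proof. by move=> u0 v0; rewrite divr_ge0 ?sqr_ge0 ?addr_ge0 ?ltW. Qed.

Lemma fisher_le u v : 0 < u -> 0 < v -> fisher u v <= u + v.
Proof.
move=> u0 v0; rewrite /fisher ler_pdivrMr ?addr_gt0//.
by rewrite -subr_ge0; have : 0 < u * v by [exact: mulr_gt0]; nra.
Qed.

Lemma fisher_eq0 u v : 0 < u -> 0 < v -> fisher u v = 0 -> u = v.
Proof.
move=> u0 v0 /eqP; rewrite mulf_eq0 sqrf_eq0 invr_eq0 subr_eq0.
by rewrite (gt_eqF (addr_gt0 u0 v0)) orbF => /eqP.
Qed.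

(** Joint convexity of [d ^+ 2 / s] in the difference [d] and the sum [s]: after clearing the
    denominator, the gap is a nonnegative multiple of the square of [d1 * s0 - d0 * s1]. *)
Lemma fisher_mix t u1 v1 u0 v0 : 0 < t < 1 ->
  0 < u1 -> 0 < v1 -> 0 < u0 -> 0 < v0 ->
  fisher ((1 - t) * u1 + t * u0) ((1 - t) * v1 + t * v0) <=
  (1 - t) * fisher u1 v1 + t * fisher u0 v0.
Proof.
move=> /andP[t0 t1] u1p v1p u0p v0p; rewrite /fisher.
set s1 := u1 + v1; set s0 := u0 + v0; set d1 := u1 - v1; set d0 := u0 - v0.
have s1p : 0 < s1 by exact: addr_gt0.
have s0p : 0 < s0 by exact: addr_gt0.
have -> : (1 - t) * u1 + t * u0 - ((1 - t) * v1 + t * v0) =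
  (1 - t) * d1 + t * d0 by rewrite /d1 /d0; ring.
have -> : (1 - t) * u1 + t * u0 + ((1 - t) * v1 + t * v0) =
  (1 - t) * s1 + t * s0 by rewrite /s1 /s0; ring.
have sp : 0 < (1 - t) * s1 + t * s0.
  by rewrite addr_gt0// mulr_gt0// subr_gt0.
rewrite ler_pdivrMr// -subr_ge0.
have -> : ((1 - t) * (d1 ^+ 2 / s1) + t * (d0 ^+ 2 / s0)) *
   ((1 - t) * s1 + t * s0) - ((1 - t) * d1 + t * d0) ^+ 2 =
   (1 - t) * t * (s1 * s0)^-1 * (d1 * s0 - d0 * s1) ^+ 2.
  by field; rewrite !gt_eqF.
by rewrite mulr_ge0 ?sqr_ge0// divr_ge0 ?mulr_ge0 ?subr_ge0 ?(ltW t0) ?(ltW t1)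
  ?(ltW s0p) ?(ltW s1p).
Qed.

(** For [v <= u], the inequality [ln x <= x - 1] at [x = v / u] gives [ln u - ln v >= (u - v) / u],
    and [u <= u + v]. *)
Lemma fisher_le_ln u v : 0 < u -> 0 < v ->
  fisher u v <= (ln u - ln v) * (u - v).
Proof.
wlog uv : u v / v <= u.
  move=> H u0 v0; have [vu|/ltW uv] := leP v u; first exact: H.
  have := H _ _ uv v0 u0.
  by rewrite /fisher -(opprB u v) -(opprB (ln u)) sqrrN mulrNN (addrC v).
move=> u0 v0; rewrite /fisher expr2 mulrAC ler_wpM2r ?subr_ge0//.
have : ln (v / u) <= v / u - 1.
  have -> : v / u = 1 + (v / u - 1) by rewrite addrC subrK.
  by rewrite [leRHS]addrC addKr le_ln1Dx// ltrBrDl subrr divr_gt0.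
rewrite ln_div ?posrE// => h.
apply: (@le_trans _ _ ((u - v) / u)).
  by rewrite ler_wpM2l ?subr_ge0// lef_pV2 ?posrE ?addr_gt0// lerDl ltW.
by rewrite mulrBl divff ?gt_eqF//; lra.
Qed.


(** With [L = ln r], the bound [expR (L / 2) >= L / 2] squares to [L ^+ 2 <= 4 * r]; one factor [L]
    is then replaced by the smaller [K]. *)
Lemma ln_le_div K r : 0 < K -> 0 < r -> K < ln r -> ln r <= 4 / K * r.
Proof.
move=> K0 r0 Kr; set L := ln r in Kr *.
have L0 : 0 < L by exact: lt_trans Kr.
have rL : L ^+ 2 / 4 <= r.
  have -> : r = expR (L / 2) ^+ 2.
    by rewrite -expRM_natl mulrC divfK// /L lnK.
  have -> : L ^+ 2 / 4 = (L / 2) ^+ 2 by field.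
  rewrite ler_sqr ?nnegrE ?expR_ge0//; last by rewrite divr_ge0// ltW.
  by apply: le_trans (expR_ge1Dx _); rewrite lerDr.
rewrite mulrAC ler_pdivlMr//.
by apply: (@le_trans _ _ (L * L)); [rewrite ler_pM2l// ltW | lra].
Qed.

(* If |ln V - ln U| <= K, use AM-GM.  Otherwise the smaller of U, V is at most
   e^-K times the larger one, which beats the logarithm. *)
Lemma boundary_term_le C K u v U V : 0 < C -> 0 < K ->
  0 < u -> 0 < v -> 0 < U -> 0 < V -> u <= C * U -> v <= C * V ->
  (ln V - ln U) * (u - v) <=
    K ^+ 3 / 4 * fisher u v + K^-1 * (u + v) + 4 * C / K * (U + V).
Proof.
move=> C0 K0.
wlog uv : u v U V / v <= u.
  move=> H u0 v0 U0 V0 uU vV; have [vu|/ltW uv] := leP v u; first exact: H.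
  have := H _ _ _ _ uv v0 u0 V0 U0 vV uU.
  by rewrite /fisher -(opprB u v) -(opprB (ln V)) sqrrN mulrNN (addrC v)
    (addrC V).
move=> u0 v0 U0 V0 uU vV.
have h1 : 0 <= 4 * C / K * (U + V).
  by rewrite !mulr_ge0 ?addr_ge0 ?invr_ge0 ?ltW.
have h2 : 0 <= K^-1 * (u + v) by rewrite mulr_ge0 ?addr_ge0 ?invr_ge0 ?ltW.
have h3 : 0 <= K ^+ 3 / 4 * fisher u v.
  by rewrite mulr_ge0 ?fisher_ge0// divr_ge0// exprn_ge0// ltW.
have [lnK|Kln] := leP (ln V - ln U) K.
  apply: (@le_trans _ _ (K * (u - v))); first by rewrite ler_wpM2r// subr_ge0.
  apply: (@le_trans _ _ (K ^+ 3 / 4 * fisher u v + K^-1 * (u + v))); last first.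
    by rewrite lerDl.
  rewrite /fisher -subr_ge0; set s := u + v; set d := u - v.
  have s0 : 0 < s by exact: addr_gt0.
  have -> : K ^+ 3 / 4 * (d ^+ 2 / s) + K^-1 * s - K * d =
    (K ^+ 2 * d - 2 * s) ^+ 2 / (4 * K * s) by field; rewrite !gt_eqF.
  by rewrite divr_ge0 ?sqr_ge0// !mulr_ge0 ?ltW.
apply: (@le_trans _ _ (4 * C / K * (U + V))); last by rewrite lerDr addr_ge0.
have VU : ln V - ln U <= 4 / K * (V / U).
  by rewrite -ln_div ?posrE// ln_le_div ?divr_gt0// ln_div ?posrE.
have {VU} VU : (ln V - ln U) * U <= 4 / K * V.
  by move: VU; rewrite mulrA ler_pdivlMr.
have L0 : 0 <= ln V - ln U by rewrite ltW// (lt_trans K0).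
apply: (@le_trans _ _ ((ln V - ln U) * (C * U))).
  by rewrite ler_wpM2l// (le_trans _ uU)// lerBlDr lerDl ltW.
rewrite mulrCA; apply: (@le_trans _ _ (C * (4 / K * V))).
  by rewrite ler_pM2l.
have -> : 4 * C / K * (U + V) = C * (4 / K * V) + 4 * C / K * U by ring.
by rewrite lerDl !mulr_ge0 ?invr_ge0// ltW.
Qed.

(* E stays below A for all n, so its increments, which bound F, cannot stay
   away from 0; hence E n <= B / K for every K. *)
Lemma dissipation_eq0 (E F : nat -> R) A B : (forall n, 0 <= E n) ->
  (forall n, 0 <= F n <= A) -> (forall n, E n + F n <= E n.+1) ->
  (forall K n, 1 <= K -> E n <= B * K ^+ 3 * F n + B / K) ->
  forall n, E n = 0.
Proof.
move=> E0 FA EF EK.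
have A0 : 0 <= A by have /andP[/le_trans] := FA 0%N; exact.
have B0 : 0 <= B.
  rewrite leNgt; apply/negP => B0; have := EK 1 0%N (lexx _).
  have /andP[F0 _] := FA 0%N; have := E0 0%N.
  by rewrite expr1n divr1 mulr1; nra.
have EB n : E n <= B * A + B.
  have /andP[_ FnA] := FA n.
  have := EK 1 n (lexx _); rewrite expr1n divr1 mulr1 => /le_trans; apply.
  by rewrite lerD2r ler_wpM2l.
have Emono m n : (m <= n)%N -> E m <= E n.
  have Eh : {homo E : i j / (i <= j)%N >-> i <= j}; last exact: Eh.
  apply: homo_leq => [//|y x z|k]; first exact: le_trans.
  have /andP[F0 _] := FA k.
  by apply: le_trans (EF k); rewrite lerDl.
suff small K n : 1 <= K -> E n <= B / K.
  move=> n; apply/eqP; rewrite eq_le E0 andbT leNgt; apply/negP => En.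
  (* For this [K], the product [E n * K] is [2 * B + E n], which exceeds [B]. *)
  have K1 : 1 <= (B + B) / E n + 1 by rewrite lerDr divr_ge0// addr_ge0.
  have := small _ n K1; apply/negP; rewrite -ltNge.
  rewrite ltr_pdivrMr ?(lt_le_trans _ K1)// mulrDr mulr1 mulrC divfK ?gt_eqF//.
  by rewrite -addrA ltrDl; lra.
move=> K1; rewrite leNgt; apply/negP => EnK.
have K0 : 0 < K by exact: lt_le_trans K1.
set d := E n - B / K.
have d0 : 0 < d by rewrite subr_gt0.
have step k : d <= B * K ^+ 3 * F (n + k)%N.
  by rewrite lerBlDr (le_trans _ (EK _ _ K1))// Emono// leq_addr.
set D := B * K ^+ 3.
have D0 : 0 < D.
  rewrite lt_neqAle mulr_ge0 ?exprn_ge0 ?(ltW K0)// andbT.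
  apply/eqP => D0; have := step 0%N.
  by rewrite -/D -D0 mul0r leNgt d0.
have grow k : d * k%:R <= D * E (n + k)%N.
  elim: k => [|k IH]; first by rewrite mulr0 mulr_ge0// ltW.
  rewrite addnS -natr1 mulrDr mulr1.
  apply: (@le_trans _ _ (D * (E (n + k)%N + F (n + k)%N))).
    by rewrite mulrDr lerD// step.
  by rewrite ler_pM2l.
pose k := Num.bound (D * (B * A + B) / d).
have := le_trans (grow k) (ler_wpM2l (ltW D0) (EB _)).
apply/negP; rewrite -ltNge (mulrC d) -ltr_pdivrMr//.
apply: archi_boundP.
by rewrite divr_ge0 ?(ltW d0)// mulr_ge0 ?(ltW D0)// addr_ge0// mulr_ge0.
Qed.

End real_inequalities.

(** * Averages over finitely many sites *)

Definition upd (x : int) (b : bool) (eta : config) : config :=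
  fun y => if y == x then b else eta y.

Lemma upd_id x eta : upd x (eta x) eta = eta.
Proof. by apply/funext => y; rewrite /upd; case: eqP => [->|]. Qed.

Lemma upd_eq x b eta : upd x b eta x = b.
Proof. by rewrite /upd eqxx. Qed.

Lemma upd_neq x y b eta : y != x -> upd x b eta y = eta y.
Proof. by rewrite /upd => /negPf->. Qed.

Lemma upd_upd x b c eta : upd x b (upd x c eta) = upd x b eta.
Proof. by apply/funext => y; rewrite /upd; case: eqP. Qed.

Lemma updC x y b c eta : x != y ->
  upd x b (upd y c eta) = upd y c (upd x b eta).
Proof.
move=> xy; apply/funext => z; rewrite /upd.
by case: eqP => [->|//]; rewrite (negPf xy).
Qed.

Lemma flip_upd x b eta : flip x (upd x b eta) = upd x (~~ b) eta.
Proof. by apply/funext => y; rewrite /flip /upd; case: eqP. Qed.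

Lemma flipE x eta : flip x eta = upd x (~~ eta x) eta.
Proof. by apply/funext => y; rewrite /flip /upd; case: eqP => [->|]. Qed.

Section averages.
Context {R : realType} (q : R).
Hypothesis hq : 0 < q < 1.
Implicit Types (f g h : config -> R) (s : seq int) (x y : int).

Let q0 : 0 < q. Proof. by case/andP: hq. Qed.
Let q1 : 0 < 1 - q. Proof. by case/andP: hq => _; rewrite subr_gt0. Qed.

Definition depends_on s f := forall eta xi : config,
  (forall x, x \in s -> eta x = xi x) -> f eta = f xi.

Definition site_average x f : config -> R :=
  fun eta => (1 - q) * f (upd x true eta) + q * f (upd x false eta).

(* The expectation of [f] under the Bernoulli product measure, when [f] depends
   on the sites of [s] only (the remaining sites are set to 1). *)
Fixpoint expect s f : R :=
  if s is x :: s' then expect s' (site_average x f) else f ones.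

Definition grad x f : config -> R :=
  fun eta => f (upd x true eta) - f (upd x false eta).

Lemma depends_on_upd s f x b eta : depends_on s f -> x \notin s ->
  f (upd x b eta) = f eta.
Proof.
move=> sf xs; apply: sf => y ys; rewrite upd_neq//.
by apply: contraNneq xs => <-.
Qed.

Lemma depends_on_sub s t f : {subset s <= t} -> depends_on s f ->
  depends_on t f.
Proof. by move=> st sf eta xi h; apply: sf => x /st; exact: h. Qed.

Lemma depends_on_comp_upd s x b f : depends_on (x :: s) f ->
  depends_on s (f \o upd x b).
Proof.
move=> sf eta xi h; apply: sf => y; rewrite inE /upd.
by case: eqP => //= _ /h.
Qed.

Lemma depends_on_average s x f : depends_on (x :: s) f ->
  depends_on s (site_average x f).
Proof.
move=> sf eta xi h; rewrite /site_average.
by congr (_ * _ + _ * _); exact: (depends_on_comp_upd _ sf h).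
Qed.

Lemma site_average_id x f : (forall b eta, f (upd x b eta) = f eta) ->
  site_average x f = f.
Proof.
by move=> fx; apply/funext => eta; rewrite /site_average !fx; ring.
Qed.

Lemma site_averageC x y f :
  site_average x (site_average y f) = site_average y (site_average x f).
Proof.
have [->//|xy] := eqVneq x y; apply/funext => eta; rewrite /site_average.
by rewrite !(updC _ _ _ xy); ring.
Qed.

Lemma site_average_idem x f :
  site_average x (site_average x f) = site_average x f.
Proof.
by apply: site_average_id => b eta; rewrite /site_average !upd_upd.
Qed.

Lemma site_averageD x f g :
  site_average x (fun eta => f eta + g eta) =
  (fun eta => site_average x f eta + site_average x g eta).
Proof. by apply/funext => eta; rewrite /site_average; ring. Qed.

Lemma site_averageMl x f g : (forall b eta, f (upd x b eta) = f eta) ->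
  site_average x (fun eta => f eta * g eta) =
  (fun eta => f eta * site_average x g eta).
Proof. by move=> fx; apply/funext => eta; rewrite /site_average !fx; ring. Qed.

Lemma le_site_average x f g : (forall eta, f eta <= g eta) ->
  forall eta, site_average x f eta <= site_average x g eta.
Proof.
by move=> fg eta; rewrite /site_average lerD// ler_wpM2l// ltW.
Qed.

(** One of the two terms of the average is [f eta] itself, and both weights [q] and [1 - q] are at
    least [q * (1 - q)]. *)
Lemma site_average_ge x f eta : (forall eta, 0 <= f eta) ->
  q * (1 - q) * f eta <= site_average x f eta.
Proof.
move=> f0; have q1' : q <= 1 by rewrite -subr_ge0 ltW.
rewrite -{1}(upd_id x eta) /site_average.
have a := f0 (upd x true eta); have b := f0 (upd x false eta).
have qa := mulr_ge0 (ltW q1) a; have qb := mulr_ge0 (ltW q0) b.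
by case: (eta x); nra.
Qed.

Lemma site_average_gt0 x f : (forall eta, 0 < f eta) ->
  forall eta, 0 < site_average x f eta.
Proof. by move=> f0 eta; rewrite addr_gt0// mulr_gt0. Qed.

Lemma grad_average x y f : x != y ->
  grad x (site_average y f) = site_average y (grad x f).
Proof.
move=> xy; apply/funext => eta; rewrite /grad /site_average.
by rewrite !(updC _ _ _ xy); ring.
Qed.

Lemma expectD s f g :
  expect s (fun eta => f eta + g eta) = expect s f + expect s g.
Proof. by elim: s f g => //= x s IH f g; rewrite site_averageD IH. Qed.

Lemma expectZ s c f : expect s (fun eta => c * f eta) = c * expect s f.
Proof. by elim: s f => //= x s IH f; rewrite site_averageMl// IH. Qed.

Lemma expectB s f g :
  expect s (fun eta => f eta - g eta) = expect s f - expect s g.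
Proof.
rewrite -[X in _ - X]mul1r -mulNr -expectZ -expectD; congr (expect s _).
by apply/funext => eta; rewrite mulN1r.
Qed.

Lemma expect_cst s c : expect s (fun=> c) = c.
Proof. by elim: s => //= x s IH; rewrite site_average_id. Qed.

Lemma expect_sum (I : Type) (r : seq I) s (F : I -> config -> R) :
  expect s (fun eta => \sum_(i <- r) F i eta) = \sum_(i <- r) expect s (F i).
Proof.
elim: r => [|i r IH]; first by under eq_fun do rewrite big_nil;
  rewrite big_nil expect_cst.
by under eq_fun do rewrite big_cons; rewrite big_cons expectD IH.
Qed.

Lemma le_expect s f g : (forall eta, f eta <= g eta) ->
  expect s f <= expect s g.
Proof. by elim: s f g => //= x s IH f g fg; exact/IH/le_site_average. Qed.

Lemma expect_ge0 s f : (forall eta, 0 <= f eta) -> 0 <= expect s f.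
Proof. by move=> f0; rewrite -(expect_cst s 0) le_expect. Qed.

Lemma expect_average s x f : x \in s ->
  expect s (site_average x f) = expect s f.
Proof.
elim: s f => //= y s IH f; rewrite inE.
have [->|xy /= xs] := eqVneq x y; first by rewrite site_average_idem.
by rewrite site_averageC IH.
Qed.

(** Every configuration on [s] has positive probability: by induction the average over the first
    site vanishes identically, and it dominates a positive multiple of [f]. *)
Lemma expect_eq0 s f : depends_on s f -> (forall eta, 0 <= f eta) ->
  expect s f = 0 -> forall eta, f eta = 0.
Proof.
elim: s f => [|x s IH] f sf f0 /= Ef eta.
  by rewrite -Ef; apply: sf.
have {}IH := IH _ (depends_on_average sf) _ Ef.
have : site_average x f eta = 0.
  by apply: IH => xi; rewrite addr_ge0// mulr_ge0// ltW.
have := site_average_ge x eta f0 => /[swap] ->.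
rewrite pmulr_rle0 ?mulr_gt0// => f_le0.
by apply/eqP; rewrite eq_le f_le0 f0.
Qed.

End averages.

(** * Energy dissipation in growing boxes *)

(** The interval [-n, n], listed from the outside inwards, so that [expect] integrates out the two
    outermost sites first. *)
Fixpoint box (n : nat) : seq int :=
  if n is n'.+1 then n'.+1%:Z :: - n'.+1%:Z :: box n' else [:: 0].

Lemma mem_box n x : (x \in box n) = (- n%:Z <= x <= n%:Z).
Proof.
elim: n => [|n IH] /=; first by rewrite inE oppr0 -eq_le eq_sym.
by rewrite !inE IH; lia.
Qed.

Lemma box_uniq n : uniq (box n).
Proof.
elim: n => [//|n IH] /=.
by rewrite !inE !mem_box IH; lia.
Qed.

Lemma box_sub m n : (m <= n)%N -> {subset box m <= box n}.
Proof. by move=> mn x; rewrite !mem_box; lia. Qed.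

Definition box_average {R : realType} (q : R) n f :=
  site_average q n.+1%:Z (site_average q (- n.+1%:Z) f).

Lemma expect_box {R : realType} (q : R) n f :
  expect q (box n.+1) f = expect q (box n) (box_average q n f).
Proof. by rewrite /= site_averageC. Qed.

Section dissipation.
Context {R : realType} (q : R) (r : rates R).
Hypothesis hq : 0 < q < 1.
Implicit Types (f : config -> R) (x y : int).

Definition dissipation x f : config -> R :=
  fun eta => r x eta * fisher (f (upd x true eta)) (f (upd x false eta)).

Hypothesis r_ge0 : forall x eta, 0 <= r x eta.

Lemma dissipation_ge0 x f : (forall eta, 0 < f eta) ->
  forall eta, 0 <= dissipation x f eta.
Proof. by move=> f0 eta; rewrite mulr_ge0 ?fisher_ge0. Qed.

(** Jensen's inequality for the jointly convex [fisher]; the rate at [x] does not see [y] and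
    factors out of the average. *)
Lemma dissipation_average x y f : x != y ->
  (forall b eta, r x (upd y b eta) = r x eta) -> (forall eta, 0 < f eta) ->
  forall eta, dissipation x (site_average q y f) eta <=
    site_average q y (dissipation x f) eta.
Proof.
move=> xy ry f0 eta; rewrite /dissipation site_averageMl// ler_wpM2l//.
apply: le_trans (fisher_mix _ _ _ _ _) _ => //.
by rewrite /site_average !(updC _ _ _ xy).
Qed.

Lemma sum_upd_le s x f : x \in s -> (forall eta, 0 < f eta) ->
  expect q s (fun eta => f (upd x true eta) + f (upd x false eta)) <=
  (q * (1 - q))^-1 * expect q s f.
Proof.
move=> xs f0; have /andP[q0 q1] := hq.
rewrite -[in leRHS](expect_average _ _ xs) -expectZ; apply: le_expect => // eta.
have m0 : 0 < q * (1 - q) by rewrite mulr_gt0// subr_gt0.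
rewrite ler_pdivlMl// /site_average.
by rewrite mulrDr lerD// ler_wpM2r ?ltW//; nra.
Qed.

End dissipation.

(** * Vanishing of the dissipation for consistent positive densities *)

Section consistent_densities.
Context {R : realType} (q : R) (hq : 0 < q < 1) (G : bool -> bool -> R) (M : R).
Hypothesis G_le : forall a b, 0 <= G a b <= M.
Hypothesis G_gt0 : forall a b, ~~ (a && b) -> 0 < G a b.

(** Common form of the three models: the rate is a function [G] of the two neighbours, assumed
    positive as soon as one of them is 0. *)
Definition edge_rate : rates R := fun x eta => G (eta (x - 1)) (eta (x + 1)).

Let rate_ge0 x eta : 0 <= edge_rate x eta.
Proof. by have /andP[] := G_le (eta (x - 1)) (eta (x + 1)). Qed.

Let rate_le x eta : edge_rate x eta <= M.
Proof. by have /andP[] := G_le (eta (x - 1)) (eta (x + 1)). Qed.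

Let rate_upd (x y : int) b eta : y != x - 1 -> y != x + 1 ->
  edge_rate x (upd y b eta) = edge_rate x eta.
Proof. by move=> y1 y2; rewrite /edge_rate !upd_neq// eq_sym. Qed.

(* [W n] plays the role of the density, with respect to the Bernoulli product
   measure, of the restriction to [box n] of a stationary measure. *)
Variable W : nat -> config -> R.
Hypothesis W_gt0 : forall n eta, 0 < W n eta.
Hypothesis W_dep : forall n, depends_on (box n) (W n).
Hypothesis W_average : forall n, W n = box_average q n (W n.+1).
Hypothesis W_stationary : forall n g, depends_on (box n) g ->
  \sum_(x <- box n) expect q (box n.+1)
     (fun eta => edge_rate x eta * grad x g eta * grad x (W n.+1) eta) = 0.

Let mass := expect q (box 0) (W 0).
Let m := q * (1 - q).
Let m_gt0 : 0 < m.
Proof. by case/andP: hq => q0 q1; rewrite mulr_gt0// subr_gt0. Qed.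

Let W_mass n : expect q (box n) (W n) = mass.
Proof. by elim: n => [//|n <-]; rewrite expect_box -W_average. Qed.

Let mass_ge0 : 0 <= mass.
Proof. by apply: expect_ge0 => // eta; exact: ltW. Qed.

Let W_succ_mass n : expect q (box n.+1) (W n) = mass.
Proof.
rewrite expect_box -(W_mass n); congr (expect q _ _); rewrite /box_average.
rewrite [site_average q (- _) _]site_average_id => [|b eta].
  rewrite site_average_id// => b eta.
  by apply: depends_on_upd (@W_dep n) _; rewrite mem_box; lia.
by apply: depends_on_upd (@W_dep n) _; rewrite mem_box; lia.
Qed.

(** [W n] averages [W n.+1] over two sites, and each average loses at most a factor [m]. *)
Let W_succ_le n eta : W n.+1 eta <= (m ^+ 2)^-1 * W n eta.
Proof.
rewrite ler_pdivlMl ?exprn_gt0// (W_average n).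
have W0 xi : 0 <= W n.+1 xi by exact: ltW.
have A0 xi : 0 <= site_average q (- n.+1%:Z) (W n.+1) xi.
  by rewrite ltW// site_average_gt0.
apply: le_trans (site_average_ge hq _ _ A0).
by rewrite -/m expr2 -mulrA ler_pM2l//; exact: site_average_ge.
Qed.

Let e x n := expect q (box n) (dissipation edge_rate x (W n)).

Let e_ge0 x n : 0 <= e x n.
Proof. by apply: expect_ge0 => // eta; exact: dissipation_ge0. Qed.

Let e_le (x : int) n : x \in box n -> e x n <= M * (m^-1 * mass).
Proof.
move=> xn; rewrite -(W_mass n).
have M0 : 0 <= M by have /andP[/le_trans] := G_le true true; exact.
apply: le_trans (ler_wpM2l M0 (sum_upd_le hq xn (W_gt0 n))).
rewrite -expectZ; apply: le_expect => // eta; rewrite /dissipation.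
apply: ler_pM => //; first exact: fisher_ge0.
exact: fisher_le.
Qed.

(** Convexity applied at the two sites of absolute value n + 2. The neighbours of [x] lie in
    [-n-1, n+1], so the rate at [x] ignores these sites. *)
Let e_mono (x : int) n : x \in box n -> e x n.+1 <= e x n.+2.
Proof.
rewrite mem_box => xn; rewrite /e [leRHS]expect_box; apply: le_expect => // eta.
rewrite {1}(W_average n.+1) /box_average.
have A0 xi : 0 < site_average q (- n.+2%:Z) (W n.+2) xi.
  exact: site_average_gt0.
apply: le_trans (dissipation_average hq _ _ _ A0 eta) _ => //; first by lia.
  by move=> b xi; apply: rate_upd; lia.
apply: le_site_average => // xi; apply: dissipation_average => //; first by lia.
by move=> b zeta; apply: rate_upd; lia.
Qed.

(** [E n] is the dissipation of the sites of [-n, n], computed in the box that also contains their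
    neighbours. [F n] is that of the two sites that join when n grows by one. *)
Let E n := \sum_(x <- box n) e x n.+1.
Let F n := e n.+1%:Z n.+2 + e (- n.+1%:Z) n.+2.

Let E_succ n : E n + F n <= E n.+1.
Proof.
rewrite /E /= !big_cons /F addrC addrA lerD2l.
by rewrite !big_seq ler_sum// => x /e_mono.
Qed.

(** Neither the rate at [x] nor [W n.+1] sees the two outermost sites, so averaging over them turns
    the gradient of [W n.+2] into that of [W n.+1]; then [fisher_le_ln] applies. *)
Let interior_term n (x : int) : x \in box n ->
  e x n.+1 <= expect q (box n.+2) (fun eta =>
    edge_rate x eta * grad x (@ln R \o W n.+1) eta * grad x (W n.+2) eta).
Proof.
rewrite mem_box => xn; rewrite [leRHS]expect_box /box_average.
have inv (y : int) b eta : y = n.+2%:Z \/ y = - n.+2%:Z ->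
    edge_rate x (upd y b eta) * grad x (@ln R \o W n.+1) (upd y b eta) =
    edge_rate x eta * grad x (@ln R \o W n.+1) eta.
  move=> yn; have yW c zeta : W n.+1 (upd y c zeta) = W n.+1 zeta.
    by apply: depends_on_upd (@W_dep n.+1) _; rewrite mem_box; lia.
  have xy : x != y by lia.
  by rewrite rate_upd; [rewrite /grad /= !(updC _ _ _ xy) !yW|lia|lia].
rewrite site_averageMl => [|b eta]; last by apply: inv; right.
rewrite site_averageMl => [|b eta]; last by apply: inv; left.
rewrite -!grad_average; [|by lia|by lia].
rewrite -/(box_average q n.+1 (W n.+2)) -W_average.
apply: le_expect => // eta; rewrite /dissipation -mulrA ler_wpM2l//.
exact: fisher_le_ln.
Qed.

(** Meant for the end sites of the box, where the rate sees a site outside and [W n.+2] cannot be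
    averaged down. Here [boundary_term_le] compares the two densities, with the constant of
    [W_succ_le]. *)
Let boundary_term n (x : int) K : x \in box n.+1 -> 1 <= K ->
  - expect q (box n.+2) (fun eta =>
      edge_rate x eta * grad x (@ln R \o W n.+1) eta * grad x (W n.+2) eta) <=
  K ^+ 3 / 4 * e x n.+2 + M * (m^-1 * mass) * (1 + 4 / m ^+ 2) / K.
Proof.
move=> xn K1; have K0 : 0 < K by exact: lt_le_trans K1.
have xn2 : x \in box n.+2 by exact: box_sub xn.
have M0 : 0 <= M by have /andP[/le_trans] := G_le true true; exact.
set C := (m ^+ 2)^-1; have C0 : 0 < C by rewrite invr_gt0 exprn_gt0.
pose s k eta := W k (upd x true eta) + W k (upd x false eta).
have s0 k eta : 0 <= s k eta by rewrite addr_ge0// ltW.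
apply: (@le_trans _ _ (expect q (box n.+2) (fun eta =>
  K ^+ 3 / 4 * dissipation edge_rate x (W n.+2) eta +
  (M / K * s n.+2 eta + M * (4 * C / K) * s n.+1 eta)))).
  rewrite -mulN1r -expectZ; apply: le_expect => // eta.
  have -> : -1 * (edge_rate x eta * grad x (@ln R \o W n.+1) eta *
      grad x (W n.+2) eta) = edge_rate x eta *
    ((ln (W n.+1 (upd x false eta)) - ln (W n.+1 (upd x true eta))) *
     (W n.+2 (upd x true eta) - W n.+2 (upd x false eta))).
    by rewrite /grad /=; ring.
  apply: le_trans (ler_wpM2l (rate_ge0 x eta) (boundary_term_le C0 K0
    (W_gt0 _ _) (W_gt0 _ _) (W_gt0 _ _) (W_gt0 _ _) (W_succ_le _ _)
    (W_succ_le _ _))) _.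
  rewrite -/(s n.+2 eta) -/(s n.+1 eta) mulrDr [X in X + _]mulrDr -addrA
    /dissipation lerD//.
    by rewrite mulrCA.
  have Ks k : 0 <= K^-1 * s k eta by rewrite mulr_ge0// invr_ge0 ltW.
  rewrite -!mulrA lerD// ler_wpM2r ?rate_le// mulr_ge0// mulr_ge0//.
  exact: ltW.
rewrite !expectD !expectZ lerD2l.
have -> : M * (m^-1 * mass) * (1 + 4 / m ^+ 2) / K =
  M / K * (m^-1 * mass) + M * (4 * C / K) * (m^-1 * mass).
  by rewrite /C; ring.
have MK : 0 <= M / K by rewrite divr_ge0// ltW.
have MCK : 0 <= M * (4 * C / K).
  by rewrite mulr_ge0// divr_ge0 ?(ltW K0)// mulr_ge0// ltW.
rewrite lerD// ler_wpM2l//.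
- by rewrite -(W_mass n.+2); exact: sum_upd_le.
- by rewrite -(W_succ_mass n.+1); exact: sum_upd_le.
Qed.

Lemma dissipation_vanishes n (x : int) eta : x \in box n ->
  dissipation edge_rate x (W n.+1) eta = 0.
Proof.
move=> xn.
have M0 : 0 <= M by have /andP[/le_trans] := G_le true true; exact.
pose B0 := M * (m^-1 * mass) * (1 + 4 / m ^+ 2).
have B00 : 0 <= B0.
  have m0 := ltW m_gt0.
  rewrite /B0 mulr_ge0//; first by rewrite mulr_ge0// mulr_ge0// invr_ge0.
  by rewrite addr_ge0// divr_ge0// exprn_ge0.
have E0 k : 0 <= E k by rewrite sumr_ge0.
have EF : forall k, E k = 0.
  (* [F] sums the bounds [e_le] at two sites. In [1 + 2 * B0], the 1 absorbs the factor 1/4 of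
     [K ^+ 3] and [2 * B0] collects the errors of both boundary terms. *)
  apply: (@dissipation_eq0 _ E F (2 * (M * (m^-1 * mass))) (1 + 2 * B0)) => //.
  - move=> k; rewrite addr_ge0//= mulr_natl mulr2n lerD// e_le//.
      by rewrite mem_box; lia.
    by rewrite mem_box; lia.
  - move=> K k K1; have K0 : 0 < K by exact: lt_le_trans K1.
    (* The test function is the logarithm of the density: the sites of [-k, k] contribute at least
       [E k], which the two end sites must balance. *)
    have dep : depends_on (box k.+1) (@ln R \o W k.+1).
      by move=> xi zeta h; rewrite /= (W_dep h).
    have := W_stationary dep; rewrite /= !big_cons.
    have in1 : k.+1%:Z \in box k.+1 by rewrite mem_box; lia.
    have in2 : - k.+1%:Z \in box k.+1 by rewrite mem_box; lia.
    have := boundary_term in1 K1; have := boundary_term in2 K1.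
    have : E k <= \sum_(x <- box k) expect q (box k.+2) (fun eta =>
        edge_rate x eta * grad x (@ln R \o W k.+1) eta * grad x (W k.+2) eta).
      by rewrite /E !big_seq ler_sum// => y /interior_term.
    rewrite /= -/B0 /F.
    set a := expect _ _ _; set b := expect _ _ _; set S := \sum_(_ <- _) _.
    move=> h1 h2 h3 h4.
    apply: (@le_trans _ _ (K ^+ 3 / 4 * F k + 2 * B0 / K)).
      by rewrite /F; lra.
    have F0 : 0 <= F k by rewrite addr_ge0.
    have K30 : 0 <= K ^+ 3 by rewrite exprn_ge0// ltW.
    rewrite -/(F k) lerD//.
      by rewrite ler_wpM2r//; nra.
    by rewrite ler_wpM2r ?invr_ge0 ?(ltW K0)// lerDr.
have e0 : e x n.+1 = 0.
  apply/eqP; have := EF n; rewrite /E => /eqP.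
  by rewrite psumr_eq0// => /allP/(_ x xn).
(* A nonnegative local function with mean 0 vanishes pointwise; the neighbours of [x] lie in the
   box, so the dissipation depends on it only. *)
apply: (expect_eq0 hq (s := box n.+1)) => //; last exact: dissipation_ge0.
move=> xi zeta h; rewrite /dissipation /edge_rate.
have xn1 := xn; rewrite mem_box in xn1.
rewrite !h ?mem_box; [|by lia|by lia].
by congr (_ * fisher _ _); apply: W_dep => y /h; rewrite /upd; case: eqP.
Qed.

(** * Invariance under legal flips and communication between configurations *)

Lemma density_upd n (x : int) b eta : x \in box n ->
  ~~ (eta (x - 1) && eta (x + 1)) -> W n.+1 (upd x b eta) = W n.+1 eta.
Proof.
move=> xn hG; have := dissipation_vanishes eta xn => /eqP.
rewrite mulf_eq0 gt_eqF/=; last exact: G_gt0.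
move=> /eqP/(fisher_eq0 (W_gt0 _ _) (W_gt0 _ _)) h.
by rewrite -[in RHS](upd_id x eta); case: b (eta x) => [] [].
Qed.

Let fill (a b : int) (eta : config) : config :=
  fun y => if a <= y <= b then false else eta y.

(** The zero at [z] spreads, first to the right and then to the left: each new site is adjacent to
    the block of zeros already made, so emptying it is legal. *)
Let fill_density n (z : int) eta (k l : nat) : eta z = false ->
  - n%:Z <= z - l%:Z -> z + k%:Z <= n%:Z ->
  W n.+1 (fill (z - l%:Z) (z + k%:Z) eta) = W n.+1 eta.
Proof.
move=> z0; elim: l => [|l IHl] ln kn.
  elim: k kn => [|k IHk] kn.
    congr (W _ _); apply/funext => y; rewrite /fill; case: ifP => // yz.
    by have -> : y = z by lia.
  rewrite -IHk; last by lia.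
  have -> : fill (z - 0%:Z) (z + k.+1%:Z) eta =
      upd (z + k.+1%:Z) false (fill (z - 0%:Z) (z + k%:Z) eta).
    apply/funext => y; rewrite /fill /upd; case: (eqVneq y (z + k.+1%:Z)) => ?.
      by rewrite ifT//; lia.
    by congr (if _ then _ else _); lia.
  apply: density_upd; first by rewrite mem_box; lia.
  by rewrite {1}/fill ifT//; lia.
rewrite -IHl; [|by lia|by lia].
have -> : fill (z - l.+1%:Z) (z + k%:Z) eta =
    upd (z - l.+1%:Z) false (fill (z - l%:Z) (z + k%:Z) eta).
  apply/funext => y; rewrite /fill /upd; case: (eqVneq y (z - l.+1%:Z)) => ?.
    by rewrite ifT//; lia.
  by congr (if _ then _ else _); lia.
apply: density_upd; first by rewrite mem_box; lia.
by rewrite andbC {1}/fill ifT//; lia.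
Qed.

Let zeros : config := fun=> false.

Let density_zeros n eta (z : int) : z \in box n -> eta z = false ->
  W n eta = W n zeros.
Proof.
move=> zn z0; rewrite (W_average n) /box_average /site_average.
(* The two outer sites keep their values [b] and [c] while [-n, n] is filled with zeros; afterwards
   both configurations agree on the larger box. *)
suff h b c : W n.+1 (upd (- n.+1%:Z) c (upd n.+1%:Z b eta)) =
    W n.+1 (upd (- n.+1%:Z) c (upd n.+1%:Z b zeros)) by rewrite !h.
move: zn; rewrite mem_box => zn.
have z0' : upd (- n.+1%:Z) c (upd n.+1%:Z b eta) z = false.
  by rewrite !upd_neq//; lia.
rewrite -(@fill_density n z _ (absz (n%:Z - z)) (absz (z + n%:Z)) z0');
  [|by lia|by lia].
apply: W_dep => y; rewrite mem_box /fill /upd => yn.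
by repeat (case: ifP) => //; lia.
Qed.

(** The value at the all-zero configuration does not depend on n: averaging over the outer sites
    leaves the zero at the origin in place. *)
Lemma density_constant : exists kappa, forall n eta z,
  z \in box n -> eta z = false -> W n eta = kappa.
Proof.
exists (W 0 zeros) => n eta z zn /(density_zeros zn) ->.
elim: n {zn} => [//|n <-]; rewrite (W_average n) /box_average /site_average.
have h b c : W n.+1 (upd (- n.+1%:Z) c (upd n.+1%:Z b zeros)) = W n.+1 zeros.
  apply: (@density_zeros _ _ 0); first by rewrite mem_box; lia.
  by rewrite !upd_neq//; lia.
by rewrite !h; ring.
Qed.

End consistent_densities.

(** * Cylinder densities of a probability measure *)

Section cylinders.
Context {R : realType}.
Implicit Types (s : seq int) (f : config -> R) (B : set config).

Definition cylinder s (sigma : config) : set config :=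
  [set eta | forall x, x \in s -> eta x = sigma x].

Lemma measurable_coordinate (x : int) (b : bool) :
  measurable [set eta : config | eta x = b].
Proof. by apply: sub_sigma_algebra; exists x, b. Qed.

Lemma cylinder_nil sigma : cylinder [::] sigma = setT.
Proof. by apply/seteqP; split. Qed.

Lemma cylinder_cons x s sigma :
  cylinder (x :: s) sigma = [set eta | eta x = sigma x] `&` cylinder s sigma.
Proof.
apply/seteqP; split=> [eta h|eta [hx hs] y]; last first.
  by rewrite inE => /orP[/eqP->|/hs].
by split=> [|y ys]; apply: h; rewrite inE ?eqxx ?ys ?orbT.
Qed.

Lemma cylinder_cons_upd x s b sigma : x \notin s ->
  cylinder (x :: s) (upd x b sigma) =
  [set eta | eta x = b] `&` cylinder s sigma.
Proof.
move=> xs; rewrite cylinder_cons upd_eq; congr (_ `&` _).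
apply/seteqP; split=> eta h y ys; rewrite h// upd_neq//;
by apply: contraNneq xs => <-.
Qed.

Lemma eq_cylinder s sigma tau : (forall x, x \in s -> sigma x = tau x) ->
  cylinder s sigma = cylinder s tau.
Proof.
by move=> st; apply/seteqP; split=> eta h x xs; rewrite h// st.
Qed.

Lemma measurable_cylinder s sigma : measurable (cylinder s sigma).
Proof.
elim: s => [|x s IH]; first by rewrite cylinder_nil; exact: measurableT.
by rewrite cylinder_cons; apply: measurableI; [exact: measurable_coordinate|].
Qed.

Lemma measurable_depends_on s f : depends_on s f -> measurable_fun setT f.
Proof.
elim: s f => [|x s IH] f sf.
  rewrite (_ : f = cst (f ones)); first exact: measurable_cst.
  by apply/funext => eta; apply: sf.
rewrite (_ : f = fun eta => if eta x then (f \o upd x true) eta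
                            else (f \o upd x false) eta); last first.
  by apply/funext => eta /=; rewrite -[LHS](congr1 f (upd_id x eta));
    case: (eta x).
apply: measurable_fun_ifT.
- apply: (@measurable_fun_bool _ _ _ _ true); rewrite setTI.
  exact: measurable_coordinate.
- by apply: IH; exact: depends_on_comp_upd.
- by apply: IH; exact: depends_on_comp_upd.
Qed.

Lemma bounded_depends_on s f : depends_on s f ->
  exists c : R, forall eta, `|f eta| <= c.
Proof.
elim: s f => [|x s IH] f sf.
  by exists `|f ones| => eta; rewrite (sf eta ones).
have [c1 h1] := IH _ (depends_on_comp_upd true sf).
have [c0 h0] := IH _ (depends_on_comp_upd false sf).
exists (Num.max c1 c0) => eta; rewrite le_max -(upd_id x eta).
by case: (eta x); [have /= -> := h1 eta|have /= -> := h0 eta; rewrite orbT].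
Qed.

Lemma continuous_depends_on s f : depends_on s f -> continuous f.
Proof.
move=> sf eta P Pf; have : nbhs eta (cylinder s eta).
  elim: s {sf} => [|x s IH]; first by rewrite cylinder_nil; exact: filterT.
  rewrite cylinder_cons; apply: filterI => //.
  have := @proj_continuous int (fun=> bool) x eta.
  by move=> /(_ [set eta x]) /=; apply; exact: discrete_set1.
apply: filterS => xi h; rewrite /= (sf xi eta)//; exact: nbhs_singleton.
Qed.

Variable q : R.
Hypothesis hq : 0 < q < 1.

Definition weight s (eta : config) : R :=
  \prod_(x <- s) (if eta x then 1 - q else q).

Lemma weight_gt0 s eta : 0 < weight s eta.
Proof.
have /andP[q0 q1] := hq; apply: prodr_gt0 => x _.
by case: ifP; rewrite ?subr_gt0.
Qed.

Lemma weight_upd s x b eta : x \notin s ->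
  weight s (upd x b eta) = weight s eta.
Proof.
move=> xs; rewrite /weight !big_seq; apply: eq_bigr => y ys; rewrite upd_neq//.
by apply: contraNneq xs => <-.
Qed.

Variable mu : probability config R.

(** The event [B] carries the values of the coordinates already treated in the induction of
    [integral_depends_on]. *)
Definition restricted_density B s eta :=
  fine (mu (B `&` cylinder s eta)) / weight s eta.

Lemma integral_depends_on s f B : uniq s -> depends_on s f -> measurable B ->
  (\int[mu]_(eta in B) (f eta)%:E =
   (expect q s (fun eta => f eta * restricted_density B s eta))%:E)%E.
Proof.
elim: s f B => [|x s IH] f B /=.
  move=> _ sf mB; rewrite (eq_integral (cst (f ones)%:E)); last first.
    by move=> eta _; rewrite (sf eta ones).
  rewrite integral_cst// /restricted_density cylinder_nil setIT /weight big_nil.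
  by rewrite divr1 EFinM fineK// fin_num_measure.
move=> /andP[xs us] sf mB.
have mBb b : measurable (B `&` [set eta | eta x = b]).
  by apply: measurableI => //; exact: measurable_coordinate.
have BE : B = (B `&` [set eta | eta x = true]) `|`
              (B `&` [set eta | eta x = false]).
  rewrite -setIUr -[LHS]setIT; congr (_ `&` _); apply/seteqP.
  by split=> eta //= _; case: (eta x); [left|right].
rewrite {1}BE integral_setU//; last 2 first.
- rewrite -BE; apply/measurable_realfun.measurable_EFinP.
  apply: measurable_funTS; exact: measurable_depends_on sf.
- by rewrite disj_set2E; apply/eqP/seteqP; split => // eta [[_ /= ->] [_]].
have half b : (\int[mu]_(eta in B `&` [set eta | eta x = b]) (f eta)%:E =
    (expect q s (fun eta => f (upd x b eta) *
       restricted_density (B `&` [set eta | eta x = b]) s eta))%:E)%E.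
  rewrite -(IH (f \o upd x b))//; last exact: depends_on_comp_upd.
  by apply: eq_integral => eta /set_mem[_ /= <-]; rewrite upd_id.
rewrite !half -EFinD -expectD; congr (expect q s _)%:E; apply/funext => eta.
have /andP[q0 q1] := hq.
have qn0 : q != 0 by rewrite gt_eqF.
have qn1 : 1 - q != 0 by rewrite gt_eqF// subr_gt0.
have wn0 : weight s eta != 0 by rewrite gt_eqF// weight_gt0.
rewrite /site_average /restricted_density !cylinder_cons_upd//.
rewrite /weight !big_cons -!/(weight s _) !weight_upd// !upd_eq !setIA.
by field; rewrite qn0 qn1 wn0.
Qed.

(** The Radon-Nikodym derivative of the marginal of [mu] on [s] with respect to the Bernoulli
    product law, for duplicate-free [s]. *)
Definition density s eta := fine (mu (cylinder s eta)) / weight s eta.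

Lemma expect_density s f : uniq s -> depends_on s f ->
  (\int[mu]_eta (f eta)%:E =
   (expect q s (fun eta => f eta * density s eta))%:E)%E.
Proof.
move=> us sf; rewrite (integral_depends_on us sf measurableT).
congr (expect q s _)%:E; apply/funext => eta.
by rewrite /restricted_density setTI.
Qed.

Lemma expect_density1 s : uniq s -> expect q s (density s) = 1.
Proof.
move=> us; have := expect_density (f := fun=> 1) us.
rewrite integral_cst// mul1e => /(_ (fun _ _ _ => erefl))/esym muE.
have [<-] := etrans muE (probability_setT mu); congr (expect q _ _).
by apply/funext => eta; rewrite mul1r.
Qed.

Lemma measure_cylinder s t sigma : uniq t -> {subset s <= t} ->
  mu (cylinder s sigma) =
  (expect q t (fun eta => \1_(cylinder s sigma) eta * density t eta))%:E.
Proof.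
move=> ut st; rewrite -[cylinder s sigma]setIT.
rewrite -integral_indic ?setIT//; last exact: measurable_cylinder.
apply: expect_density => // eta xi h; rewrite !indicE.
have -> // : (eta \in cylinder s sigma) = (xi \in cylinder s sigma).
by apply/idP/idP => /set_mem hs; apply/mem_set => x xs; rewrite -hs// h// st.
Qed.

Lemma density_average x s : x \notin s ->
  site_average q x (density (x :: s)) = density s.
Proof.
move=> xs; apply/funext => eta; rewrite /site_average /density.
rewrite !cylinder_cons_upd// /weight !big_cons -!/(weight s _) !weight_upd//.
rewrite !upd_eq.
have mI b : measurable ([set xi : config | xi x = b] `&` cylinder s eta).
  apply: measurableI; first exact: measurable_coordinate.
  exact: measurable_cylinder.
have -> : mu (cylinder s eta) = (mu ([set xi | xi x = true] `&` cylinder s eta)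
    + mu ([set xi | xi x = false] `&` cylinder s eta))%E.
  rewrite -measureU.
  - rewrite -setIUl (_ : _ `|` _ = setT) ?setTI//; apply/seteqP.
    by split=> // xi _ /=; case: (xi x); [left|right].
  - exact: mI.
  - exact: mI.
  - by apply/seteqP; split => // xi [[/= -> _] []].
rewrite fineD ?fin_num_measure//; have /andP[q0 q1] := hq.
have qn0 : q != 0 by rewrite gt_eqF.
have qn1 : 1 - q != 0 by rewrite gt_eqF// subr_gt0.
have wn0 : weight s eta != 0 by rewrite gt_eqF// weight_gt0.
by field; rewrite qn0 qn1 wn0.
Qed.

Lemma density_ge0 s eta : 0 <= density s eta.
Proof. by rewrite divr_ge0 ?fine_ge0// ltW// weight_gt0. Qed.

Lemma depends_on_density s : depends_on s (density s).
Proof.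
move=> eta xi h; rewrite /density (eq_cylinder h) /weight; congr (_ / _).
by rewrite !big_seq; apply: eq_bigr => x /h ->.
Qed.

End cylinders.

(* No measurability is needed: the integral of a nonnegative function is the
   supremum of the integrals of the simple functions below it.  This matters
   because [S t f] is only known to be continuous. *)
Lemma ge0_le_integralT {d} {T : measurableType d} {R : realType}
    (mu : {measure set T -> \bar R}) (f g : T -> \bar R) :
  (forall x, 0 <= f x)%E -> (forall x, f x <= g x)%E ->
  (\int[mu]_x f x <= \int[mu]_x g x)%E.
Proof.
move=> f0 fg; rewrite !ge0_integralTE//; last first.
  by move=> x; exact: le_trans (fg x).
apply: le_ereal_sup => _ [h hf <-]; exists h => // x.
exact: le_trans (hf x) (fg x).
Qed.

(** * Stationary measures *)

Section stationary_measures.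
Context {R : realType} (q : R) (hq : 0 < q < 1).
Context (G : bool -> bool -> R) (M : R).
Hypothesis G_le : forall a b, 0 <= G a b <= M.
Hypothesis G_gt0 : forall a b, ~~ (a && b) -> 0 < G a b.

Lemma generator_box n (g : config -> R) eta : depends_on (box n) g ->
  generator q (edge_rate G) g eta = \sum_(x <- box n)
    edge_rate G x eta * ((1 - occ eta x) * (1 - q) + occ eta x * q) *
    (g (flip x eta) - g eta).
Proof.
move=> gn; rewrite /generator [RHS]fsbig_seq ?box_uniq//.
symmetry; apply: (fsbig_widen [set` box n] setT) => // x [_ /= /negP xn].
by rewrite flipE (depends_on_upd _ _ gn xn) subrr mulr0.
Qed.

Lemma depends_on_generator n (g : config -> R) : depends_on (box n) g ->
  depends_on (box n.+1) (generator q (edge_rate G) g).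
Proof.
move=> gn eta xi h; rewrite !(generator_box _ gn) !big_seq.
apply: eq_bigr => x; rewrite mem_box => xn.
rewrite /edge_rate /occ !h ?mem_box; [|by lia|by lia|by lia].
congr (_ * (_ - _)); apply: gn => y yn; last by apply: h; exact: box_sub yn.
have hy : eta y = xi y by apply: h; exact: box_sub yn.
by rewrite /flip hy.
Qed.

Variable mu : probability config R.

(** For small t, [S t g] is at least [g + t * (L - e)] everywhere; integrating and using
    stationarity leaves at most [e] for the mean of [L]. *)
Lemma integral_generator_le0 (S : R -> (config -> R) -> config -> R) n g :
  feller_process q (edge_rate G) S -> stationary S mu ->
  depends_on (box n) g ->
  expect q (box n.+1) (fun eta =>
    generator q (edge_rate G) g eta * density q mu (box n.+1) eta) <= 0.
Proof.
move=> [Sfeller Sgen] Smu gn; have gn1 := depends_on_generator gn.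
set L := generator q (edge_rate G) g in gn1 *.
pose D := density q mu (box n.+1).
have D0 eta : 0 <= D eta by exact: density_ge0.
have gn1' : depends_on (box n.+1) g.
  by apply: depends_on_sub gn; exact: box_sub.
have cst1 : continuous (fun _ : config => 1 : R).
  by move=> eta; exact: cvg_cst.
have gc : continuous g by exact: continuous_depends_on gn.
have [a ha] := bounded_depends_on gn.
have [b hb] := bounded_depends_on gn1.
suff le_e (e : R) : 0 < e ->
    expect q (box n.+1) (fun eta => L eta * D eta) <= e.
  by apply/ler_addgt0Pr => e e0; rewrite add0r le_e.
move=> e0.
have [t [t0 ht]] : exists t : R, 0 < t /\
    forall eta, `|L eta - t^-1 * (S t g eta - g eta)| < e.
  have := Sgen g (ex_intro _ (box n) gn).
  move=> /(_ [set h : config -> R | forall eta, `|L eta - h eta| < e]) [].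
    apply/uniform_nbhs; exists [set xy | `|xy.1 - xy.2| < e]; split.
      by rewrite -entourage_ballE; exists e.
    by move=> h hh eta; exact: hh.
  move=> d d0 hd; exists (d / 2); split; first by rewrite divr_gt0.
  apply: hd; last by rewrite divr_gt0.
  rewrite /= sub0r normrN gtr0_norm ?divr_gt0//.
  by rewrite ltr_pdivrMr// ltr_pMr// ltr1n.
(* This constant makes the lower bound [h'] nonnegative, as [ge0_le_integralT] requires; [S t]
   preserves constants, so it cancels in the end. *)
pose k := a + t * (b + e).
pose h eta := k * 1 + g eta.
pose h' eta := k + (g eta + t * (L eta - e)).
have h'0 eta : 0 <= h' eta.
  rewrite /h' /k.
  have := ha eta; rewrite ler_norml => /andP[ga _].
  have := hb eta; rewrite ler_norml => /andP[Lb _].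
  have : 0 <= t * (b + L eta) by rewrite mulr_ge0 ?(ltW t0)//; lra.
  by lra.
have hn : depends_on (box n.+1) h.
  by move=> eta xi hx; rewrite /h (gn1' _ _ hx).
have h'n : depends_on (box n.+1) h'.
  by move=> eta xi hx; rewrite /h' (gn1' _ _ hx) (gn1 _ _ hx).
have Sh : S t h = fun eta => k * 1 + S t g eta.
  have := feller_linear Sfeller k (ltW t0) cst1 gc.
  by rewrite (feller_one Sfeller (ltW t0)).
have h'S eta : h' eta <= S t h eta.
  rewrite Sh /h' mulr1 lerD2l -lerBrDl -ler_pdivlMl//.
  by have := ht eta; rewrite ltr_norml => /andP[_ ?]; lra.
have := Smu t h (ltW t0) (continuous_depends_on hn).
rewrite (expect_density hq mu (box_uniq _) hn) => Smuh.
have : (\int[mu]_eta (h' eta)%:E <= \int[mu]_eta (S t h eta)%:E)%E.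
  by apply: ge0_le_integralT => eta; rewrite lee_fin.
rewrite Smuh (expect_density hq mu (box_uniq _) h'n) lee_fin -subr_ge0 -expectB.
have D1 : expect q (box n.+1) D = 1 by rewrite expect_density1// box_uniq.
have -> : (fun eta => h eta * density q mu (box n.+1) eta -
    h' eta * density q mu (box n.+1) eta) =
  (fun eta => t * e * D eta - t * (L eta * D eta)).
  by apply/funext => eta; rewrite /h /h' /D; ring.
rewrite expectB !expectZ D1 mulr1 -mulrBr pmulr_rge0// subr_ge0.
by [].
Qed.

Lemma expect_generator (S : R -> (config -> R) -> config -> R) n g :
  feller_process q (edge_rate G) S -> stationary S mu ->
  depends_on (box n) g ->
  expect q (box n.+1) (fun eta =>
    generator q (edge_rate G) g eta * density q mu (box n.+1) eta) = 0.
Proof.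
move=> Sf Smu gn; apply/eqP; rewrite eq_le (integral_generator_le0 Sf)//=.
have gnN : depends_on (box n) (fun eta => - g eta).
  by move=> eta xi h; rewrite (gn _ _ h).
have := integral_generator_le0 Sf Smu gnN.
rewrite -oppr_ge0 -mulN1r -expectZ; congr (0 <= expect q _ _).
apply/funext => eta; rewrite mulrA; congr (_ * _).
rewrite (generator_box _ gnN) (generator_box _ gn) mulr_sumr.
by apply: eq_bigr => x _; ring.
Qed.

(** Reversibility: at each site the flips 1 to 0 and 0 to 1 both carry the weight [q * (1 - q)], so
    averaging over the site turns the generator term into [- (q * (1 - q))] times a product of
    gradients. *)
Lemma flux_balance (S : R -> (config -> R) -> config -> R) n g :
  feller_process q (edge_rate G) S -> stationary S mu ->
  depends_on (box n) g ->
  \sum_(x <- box n) expect q (box n.+1) (fun eta =>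
    edge_rate G x eta * grad x g eta *
    grad x (density q mu (box n.+1)) eta) = 0.
Proof.
move=> Sf Smu gn; have := expect_generator Sf Smu gn.
have /andP[q0 q1] := hq.
pose T x eta := edge_rate G x eta *
  ((1 - occ eta x) * (1 - q) + occ eta x * q) * (g (flip x eta) - g eta) *
  density q mu (box n.+1) eta.
rewrite (_ : (fun eta => _) = fun eta => \sum_(x <- box n) T x eta); last first.
  by apply/funext => eta; rewrite (generator_box _ gn) mulr_suml.
rewrite expect_sum => sum0.
have cn0 : - (q * (1 - q)) != 0.
  by rewrite oppr_eq0 mulf_neq0 ?gt_eqF// subr_gt0.
apply: (mulfI cn0); rewrite mulr0 mulr_sumr -[RHS]sum0.
rewrite !big_seq; apply: eq_bigr => x xn.
rewrite -[RHS](expect_average _ _ (box_sub (leqnSn n) xn)) -expectZ.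
congr (expect q _ _); apply/funext => eta.
have rx c : edge_rate G x (upd x c eta) = edge_rate G x eta.
  by rewrite /edge_rate !upd_neq//; lia.
rewrite /site_average /T !flip_upd !rx /occ !upd_eq /grad /=.
by ring.
Qed.

Lemma density_constant_away_from_ones S :
  feller_process q (edge_rate G) S -> stationary S mu ->
  exists lambda, forall n eta z, z \in box n -> eta z = false ->
    density q mu (box n) eta = lambda.
Proof.
move=> Sf Smu.
(* Adding 1 makes the logarithm available; it preserves consistency under averages and is invisible
   to gradients. *)
pose W n eta := 1 + density q mu (box n) eta.
have W0 n eta : 0 < W n eta.
  by rewrite ltr_pwDl// density_ge0.
have Wdep n : depends_on (box n) (W n).
  by move=> eta xi h; rewrite /W (depends_on_density _ _ h).
have Wav n : W n = box_average q n (W n.+1).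
  have av x s : x \notin s ->
      site_average q x (fun eta => 1 + density q mu (x :: s) eta) =
      fun eta => 1 + density q mu s eta.
    move=> xs; rewrite -(density_average hq mu xs); apply/funext => eta.
    by rewrite /site_average; ring.
  have := box_uniq n.+1; rewrite /= => /andP[xs /andP[ys _]].
  by rewrite /box_average site_averageC /W /= !av.
have Wst n g : depends_on (box n) g -> \sum_(x <- box n)
    expect q (box n.+1) (fun eta =>
      edge_rate G x eta * grad x g eta * grad x (W n.+1) eta) = 0.
  move=> gn; rewrite -[RHS](flux_balance Sf Smu gn); apply: eq_bigr => x _.
  congr (expect q _ _); apply/funext => eta; rewrite /grad /W.
  by ring.
have [kappa hk] := density_constant hq G_le G_gt0 W0 Wdep Wav Wst.
exists (kappa - 1) => n eta z zn z0.
by rewrite -(hk _ _ _ zn z0) /W addrC addKr.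
Qed.

End stationary_measures.

(** * From cylinder densities to the mixture of measures *)

Section mixtures.
Context {R : realType} (q : R) (hq : 0 < q < 1) (pi : probability config R).
Hypothesis hpi : bernoulli_product q pi.

Lemma subset_box (s : seq int) : exists n, {subset s <= box n}.
Proof.
elim: s => [|x s [n IH]]; first by exists 0%N.
exists (maxn n (absz x)) => y; rewrite inE => /orP[/eqP->|/IH].
  by rewrite mem_box; lia.
by apply: box_sub; exact: leq_maxl.
Qed.

Lemma density_bernoulli s eta : uniq s -> density q pi s eta = 1.
Proof.
by move=> us; rewrite /density hpi//= divff// gt_eqF// weight_gt0.
Qed.

Lemma density_dirac_ones s eta z : z \in s -> eta z = false ->
  density q \d_ones s eta = 0.
Proof.
move=> zs z0; have d0 : \d_ones (cylinder s eta) = 0%E :> \bar R.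
  by rewrite diracE memNset//= => /(_ z zs); rewrite z0.
by rewrite /density [X in fine X]d0 mul0r.
Qed.

(** Together with the empty set, the cylinders are stable under intersection and generate the
    sigma-algebra: a nonempty intersection is the cylinder over both site lists around any of its
    points. *)
Lemma measure_ext_cylinder (m1 m2 : {measure set config -> \bar R}) :
  (m1 setT < +oo)%E ->
  (forall s sigma, m1 (cylinder s sigma) = m2 (cylinder s sigma)) ->
  forall A : set config, measurable A -> m1 A = m2 A.
Proof.
move=> m1oo m12 A mA.
pose C := [set B | B = set0 \/ exists s sigma, B = cylinder s sigma].
have CI : setI_closed [set B | C B /\ B `<=` setT].
  move=> B1 B2 [[->|[s1 [sigma1 ->]]] _].
    by rewrite set0I; split => //; left.
  move=> [[->|[s2 [sigma2 ->]]] _]; first by rewrite setI0; split => //; left.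
  split => //; have [->|/set0P[eta [h1 h2]]] :=
    eqVneq (cylinder s1 sigma1 `&` cylinder s2 sigma2) set0; first by left.
  right; exists (s1 ++ s2), eta; apply/seteqP; split => [xi [x1 x2] x|xi h].
    rewrite mem_cat => /orP[xs|xs]; first by rewrite (x1 x xs) (h1 x xs).
    by rewrite (x2 x xs) (h2 x xs).
  split=> x xs; first by rewrite -(h1 x xs) h// mem_cat xs.
  by rewrite -(h2 x xs) h// mem_cat xs orbT.
have m12T : m1 setT = m2 setT by have := m12 [::] ones; rewrite cylinder_nil.
apply: (g_sigma_algebra_measure_unique_trace C setT measurableT _ CI) => //.
- move=> B [[->|[s [sigma ->]]] _]; first exact: measurable0.
  exact: measurable_cylinder.
- by move=> B [[->|[s [sigma ->]]] _]; rewrite ?measure0.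
- apply: sub_sigma_algebra2 mA => _ [x [b ->]]; split => //; right.
  exists [:: x], (fun=> b); apply/seteqP; split => [eta h y|eta]; last first.
    by apply; rewrite inE.
  by rewrite inE => /eqP->.
Qed.

(** The densities of [mu] and of the mixture agree wherever there is a zero in the box; total mass 1
    then fixes the value at the configuration 1. *)
Lemma mixture_of_density (mu : probability config R) lambda :
  (forall n eta z, z \in box n -> eta z = false ->
     density q mu (box n) eta = lambda) ->
  0 <= lambda <= 1 /\ forall A : set config, measurable A ->
    (mu A = lambda%:E * pi A + (1 - lambda)%:E * \d_ones A)%E.
Proof.
move=> hl; have /andP[q0 q1] := hq.
pose D n eta := density q mu (box n) eta -
  (lambda * density q pi (box n) eta +
   (1 - lambda) * density q \d_ones (box n) eta).
have D_zero n eta z : z \in box n -> eta z = false -> D n eta = 0.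
  move=> zn z0; rewrite /D (hl _ _ _ zn z0) density_bernoulli ?box_uniq//.
  by rewrite (density_dirac_ones zn z0) mulr0 addr0 mulr1 subrr.
have D_dep n : depends_on (box n) (D n).
  by move=> eta xi h; rewrite /D !(depends_on_density _ _ h).
have D_expect n : expect q (box n) (D n) = 0.
  rewrite expectB expectD !expectZ !expect_density1 ?box_uniq//.
  by rewrite !mulr1 subrKC subrr.
have dens n eta : density q mu (box n) eta =
    lambda * density q pi (box n) eta +
    (1 - lambda) * density q \d_ones (box n) eta.
  apply/eqP; rewrite -subr_eq0 -/(D n eta); apply/eqP.
  (* Hence [D n ones * D n xi] is nonnegative in [xi] with mean 0, so it vanishes, in particular at
     [ones]. *)
  have D_cases xi : D n xi = 0 \/ D n xi = D n ones.
    have [h|/existsNP[z /not_implyP[zn /negP/negbTE z0]]] :=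
      pselect (forall x, x \in box n -> xi x); first by right; exact: D_dep.
    by left; exact: D_zero zn z0.
  have DD0 : D n ones * D n ones = 0.
    apply: (expect_eq0 hq (s := box n) (f := fun xi => D n ones * D n xi)).
    - by move=> xi zeta h; rewrite (D_dep _ _ _ h).
    - by move=> xi; case: (D_cases xi) => ->; rewrite ?mulr0// -expr2 sqr_ge0.
    - by rewrite expectZ D_expect mulr0.
  have D1 : D n ones = 0 by apply/eqP; rewrite -sqrf_eq0 expr2 DD0.
  by case: (D_cases eta) => // ->.
have l0 : 0 <= lambda.
  have z0 : 0 \in box 0 by rewrite mem_box.
  by rewrite -(hl 0%N (fun=> false) 0 z0)//; exact: density_ge0.
have w_le n : weight q (box n) ones <= (1 - q) ^+ n.
  elim: n => [|n IH]; first by rewrite /weight big_seq1 /= expr0 gerBl ltW.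
  have w0 := weight_gt0 hq (box n) ones.
  rewrite /weight /= !big_cons -/(weight q (box n) ones) /= exprS.
  have q1' : 0 < 1 - q by rewrite subr_gt0.
  rewrite ler_pM2l// (le_trans _ IH)// ger_pMl// gerBl; exact: ltW.
have l1 : lambda <= 1.
  (* The density of [mu] at [ones], times the weight w of the box, is [lambda * w + (1 - lambda)]
     and must be nonnegative. As n grows, w tends to 0, which excludes [lambda > 1]. *)
  have w_ge n : lambda - 1 <= lambda * (1 - q) ^+ n.
    have w0 := weight_gt0 hq (box n) ones.
    have d1 : \d_ones (cylinder (box n) ones) = 1%E :> \bar R.
      by rewrite diracE mem_set.
    have := dens n ones; rewrite density_bernoulli ?box_uniq// mulr1.
    rewrite {2}/density [X in fine X]d1 /= mul1r => dE.
    have := density_ge0 hq mu (box n) ones; rewrite dE.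
    rewrite -(pmulr_lge0 _ w0) mulrDl -mulrA mulVf ?gt_eqF// mulr1 => h.
    by have := ler_wpM2l l0 (w_le n); lra.
  rewrite leNgt; apply/negP => l1.
  have e0 : 0 < (lambda - 1) / lambda.
    by rewrite divr_gt0 ?subr_gt0// (lt_trans _ l1).
  have q_lt1 : `|1 - q| < 1 by rewrite ger0_norm ?subr_ge0 ?(ltW q1)// gtrBl.
  have /cvgrPdist_lt/(_ _ e0)[n _ /(_ n (leqnn n))] := cvg_expr q_lt1.
  rewrite /= sub0r normrN ger0_norm ?exprn_ge0 ?subr_ge0 ?(ltW q1)//.
  rewrite ltr_pdivlMr ?(lt_trans _ l1)// mulrC ltNge.
  by rewrite w_ge.
split; first by rewrite l0.
have l1' : 0 <= 1 - lambda by rewrite subr_ge0.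
pose nu : {measure set config -> \bar R} :=
  measure_add (mscale (NngNum l0) pi) (mscale (NngNum l1') \d_ones).
have nuE A : nu A = (lambda%:E * pi A + (1 - lambda)%:E * \d_ones A)%E.
  exact: (measure_addE (mscale (NngNum l0) pi) (mscale (NngNum l1') \d_ones) A).
move=> A mA; rewrite -nuE; apply: measure_ext_cylinder mA.
  by rewrite ltey_eq fin_num_measure.
move=> s sigma; rewrite nuE; have [n sn] := subset_box s.
apply: etrans (measure_cylinder hq mu sigma (box_uniq n) sn) _.
rewrite !(measure_cylinder hq _ _ (box_uniq n) sn) -!EFinM -EFinD.
rewrite -!expectZ -expectD; congr (expect q _ _)%:E; apply/funext => eta.
by rewrite dens; ring.
Qed.

End mixtures.

(** * Application to FA-1f, BABP and delta-West *)

Lemma stationary_mixture (R : realType) (q : R) (pi mu : probability config R)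
    (G : bool -> bool -> R) (M : R) (S : R -> (config -> R) -> config -> R) :
  0 < q < 1 -> bernoulli_product q pi ->
  (forall a b, 0 <= G a b <= M) -> (forall a b, ~~ (a && b) -> 0 < G a b) ->
  feller_process q (edge_rate G) S -> stationary S mu ->
  exists lambda : R, 0 <= lambda <= 1 /\
    forall A : set config, measurable A ->
      (mu A = lambda%:E * pi A + (1 - lambda)%:E * \d_ones A)%E.
Proof.
move=> hq hpi G_le G_gt0 Sf Smu.
have [lambda hl] := density_constant_away_from_ones hq G_le G_gt0 Sf Smu.
by exists lambda; exact: (mixture_of_density hq hpi hl).
Qed.

Theorem corollary2p9 (R : realType) (q : R) (pi : probability config R)
    (hq : 0 < q < 1) (hpi : bernoulli_product q pi) :
  [/\ (forall (S : R -> (config -> R) -> (config -> R))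
         (mu : probability config R),
         feller_process q (@fa1f_rate R) S -> stationary S mu ->
         exists lambda : R, 0 <= lambda <= 1 /\
           forall A : set config, measurable A ->
             (mu A = lambda%:E * pi A + (1 - lambda)%:E * \d_ones A)%E),
      (forall (S : R -> (config -> R) -> (config -> R))
         (mu : probability config R),
         feller_process q (@babp_rate R) S -> stationary S mu ->
         exists lambda : R, 0 <= lambda <= 1 /\
           forall A : set config, measurable A ->
             (mu A = lambda%:E * pi A + (1 - lambda)%:E * \d_ones A)%E)
    & (forall delta : R, 0 < delta <= 1 ->
         forall (S : R -> (config -> R) -> (config -> R))
         (mu : probability config R),
         feller_process q (west_rate delta) S -> stationary S mu ->
         exists lambda : R, 0 <= lambda <= 1 /\
           forall A : set config, measurable A ->
             (mu A = lambda%:E * pi A + (1 - lambda)%:E * \d_ones A)%E)].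
Proof.
(* The bound 2 on the rates serves all three models; for delta-West the largest rate is
   [1 + delta]. *)
split=> [S mu|S mu|delta /andP[delta0 delta1] S mu].
- apply: (@stationary_mixture _ _ _ _ (fun a b => (a%:R + b%:R != 2 :> R)%:R) 2
    S hq hpi) => [a b|a b].
    by case: (_ != _); rewrite /= ?ler01 ?ler0n ?ler1n ?lexx.
  by case: a b => [] [] //= _; rewrite ltr0n lt0b; apply/eqP; lra.
- apply: (@stationary_mixture _ _ _ _ (fun a b => 2 - a%:R - b%:R) 2 S hq hpi)
    => [a b|a b].
    by case: a b => [] [] /=; lra.
  by case: a b => [] [] //= _; lra.
- apply: (@stationary_mixture _ _ _ _
    (fun a b => 1 - a%:R + delta * (1 - b%:R)) 2 S hq hpi) => [a b|a b].
    by case: a b => [] [] /=; lra.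
  by case: a b => [] [] //= _; lra.
Qed.
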